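(* Suppose that for each $\theta\in B_R(\theta^\dagger)$ the equation $F_\theta(u)=\varphi$ is solvable at some $u^*\in B_{r/2}(u^\dagger)$, and that there are constants $M_r,\mu_r,C_{coe}>0$ such that for all $\theta\in B_R(\theta^\dagger)$ and all $u,v\in B_r(u^\dagger)$ $$\|F_\theta'(u)\|_{\mathcal V\to\mathcal U^*\times H}\le M_r<\sqrt2,$$ $$2\big(F_\theta(u)-F_\theta(v),F_\theta'(u)(u-v)\big)_{\mathcal U^*\times H}\ge(M_r^2+\mu_r)\|F_\theta(u)-F_\theta(v)\|^2_{\mathcal U^*\times H},$$ $$C_{coe}\|F_\theta(u)-F_\theta(v)\|_{\mathcal U^*\times H}\ge\|u-v\|_{\mathcal V}.$$ Let $u_0\in B_{r/2}(u^* )$ and $u_{k+1}=u_k-F_\theta'(u_k)^*(F_\theta(u_k)-\varphi)$ for $k\ge0$. Assume that $F_\theta'(u_k)^*:\mathcal U^*\times H\to\mathcal V$ is injective for all $k$, and moreover $$C_{coe}^2\big(C_{coe}^2M_r^2-1\big)<\mu_r.$$ Then the residual sequence $\|F_\theta(u_k)-\varphi\|_{\mathcal U^*\times H}$ decreases monotonically in $k$, i.e. $\|F_\theta(u_{k+1})-\varphi\|_{\mathcal U^*\times H}\le\|F_\theta(u_k)-\varphi\|_{\mathcal U^*\times H}$ for all $k$.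
   Context: Let $T>0$, let $X$ be a Hilbert space, and let $U\hookrightarrow H\hookrightarrow U^*$ be a Gelfand triple of Hilbert spaces. Put $\mathcal U=L^2(0,T;U)$, $\mathcal U^*=L^2(0,T;U^* )$, and $\mathcal V=\{u\in\mathcal U:\dot u\in\mathcal U^*\}$ (a Hilbert space, continuously embedded in $C([0,T];H)$). Let $A:X\to H$ be linear and bounded, and let $f:(0,T)\times X\times U\to U^*$ be a (nonlinear) Carathéodory map inducing a Nemytskii operator $f:X\times\mathcal V\to\mathcal U^*$, $[f(\theta,u)](t)=f(t,\theta,u(t))$. For $\theta\in X$ define $$F_\theta:\mathcal V\to\mathcal U^*\times H,\qquad F_\theta(u)=\big(\dot u+f(\theta,u),\;A\theta-u|_{t=0}\big),\qquad \varphi:=(0,0)\in\mathcal U^*\times H.$$ $F_\theta$ is (Fréchet) differentiable in $u$ with derivative $F_\theta'(u):\mathcal V\to\mathcal U^*\times H$, and $F_\theta'(u)^*:\mathcal U^*\times H\to\mathcal V$ is its Hilbert space adjoint. $\theta^\dagger\in X$ is the exact parameter and $u^\dagger\in\mathcal V$ the corresponding exact state, $F_{\theta^\dagger}(u^\dagger)=\varphi$. $B_R(\theta^\dagger)\subset X$ is the ball of radius $R>0$ about $\theta^\dagger$; $B_\rho(w)\subseteq\mathcal V$ is the closed ball of radius $\rho$ about $w$; $r>0$ is fixed. *)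

(* Defs.v *)
From HB Require Import structures.
From mathcomp Require Import all_boot all_order all_algebra.
From mathcomp Require Import all_classical all_reals all_analysis.
From mathcomp Require Import measurable_realfun ring lra.
Set Implicit Arguments.
Unset Strict Implicit.
Unset Printing Implicit Defensive.
Import Order.TTheory GRing.Theory Num.Theory.
Import numFieldNormedType.Exports.
Local Open Scope classical_set_scope.
Local Open Scope ring_scope.

(* Real inner product spaces, as normed modules whose norm is the one of the
   inner product. *)
HB.mixin Record NormedModule_hasInner (R : realType) V
    & NormedModule R V := {
  inner : V -> V -> R;
  innerC : forall x y, inner x y = inner y x;
  inner_linl : forall (a : R) (x y z : V),
    inner (a *: x + y) z = a * inner x z + inner y z;
  inner_norm : forall x, inner x x = `|x| ^+ 2
}.

#[short(type="prehilbertType")]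
HB.structure Definition PreHilbert (R : realType) :=
  {V of NormedModule R V & NormedModule_hasInner R V}.

#[short(type="hilbertType")]
HB.structure Definition Hilbert (R : realType) :=
  {V of CompleteNormedModule R V & NormedModule_hasInner R V}.

(* Norm and topology of an inner product on a bare module. *)
HB.factory Record Lmodule_hasInner (R : realType) V & GRing.Lmodule R V := {
  ip : V -> V -> R;
  ipC : forall x y, ip x y = ip y x;
  ip_linl : forall (a : R) (x y z : V),
    ip (a *: x + y) z = a * ip x z + ip y z;
  ip_ge0 : forall x, 0 <= ip x x;
  ip_eq0 : forall x, ip x x = 0 -> x = 0
}.

HB.builders Context R V & Lmodule_hasInner R V.

Let nrm x := Num.sqrt (ip x x).

Let ipD x y z : ip (x + y) z = ip x z + ip y z.
Proof. by rewrite -{1}[x]scale1r ip_linl mul1r. Qed.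

Let ip0 z : ip 0 z = 0.
Proof. by apply: (@addrI _ (ip 0 z)); rewrite -ipD !addr0. Qed.

Let ipZ a x z : ip (a *: x) z = a * ip x z.
Proof. by rewrite -{1}[a *: x]addr0 ip_linl ip0 addr0. Qed.

Let ipDr x y z : ip x (y + z) = ip x y + ip x z.
Proof. by rewrite ipC ipD !(ipC x). Qed.

Let ipZr a x z : ip x (a *: z) = a * ip x z.
Proof. by rewrite ipC ipZ (ipC x). Qed.

Let cauchy_schwarz x y : ip x y <= nrm x * nrm y.
Proof.
have [x0|x0] := eqVneq (ip x x) 0.
  by rewrite (ip_eq0 x0) ip0 mulr_ge0// sqrtr_ge0.
apply: (le_trans (ler_norm _)).
rewrite /nrm -sqrtrM ?ip_ge0// -sqrtr_sqr ler_wsqrtr//.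
have xgt0 : 0 < ip x x by rewrite lt_neqAle eq_sym x0 ip_ge0.
have := ip_ge0 (ip x x *: y + (- ip x y) *: x).
rewrite !(ipD, ipZ, ipDr, ipZr) (ipC y x).
rewrite [X in 0 <= X](_ : _ = ip x x * (ip x x * ip y y - ip x y ^+ 2)).
  by rewrite pmulr_rge0// subr_ge0.
ring.
Qed.

Let nrmD x y : nrm (x + y) <= nrm x + nrm y.
Proof.
rewrite -(@ler_pXn2r _ 2)// ?nnegrE ?addr_ge0 ?sqrtr_ge0//.
rewrite sqrrD !sqr_sqrtr ?ip_ge0// ipD [ip x _]ipC [ip y _]ipC !ipD.
rewrite (ipC y x); have := cauchy_schwarz x y.
by rewrite -mulr_natl; lra.
Qed.

Let nrmZ (l : R) x : nrm (l *: x) = `|l| * nrm x.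
Proof.
by rewrite /nrm ipZ ipC ipZ mulrA -expr2 sqrtrM ?sqr_ge0// sqrtr_sqr.
Qed.

Let nrm0 x : nrm x = 0 -> x = 0.
Proof.
by move=> /eqP; rewrite sqrtr_eq0 => x0; apply/ip_eq0/eqP; rewrite eq_le x0 ip_ge0.
Qed.

HB.instance Definition _ := Lmodule_isNormed.Build R V nrmD nrmZ nrm0.

Let ip_norm x : ip x x = `|x| ^+ 2.
Proof. by rewrite sqr_sqrtr ?ip_ge0. Qed.

HB.instance Definition _ := NormedModule_hasInner.Build R V ipC ip_linl ip_norm.

HB.end.

Section inner_theory.
Context (R : realType) (E : prehilbertType R).
Implicit Types x y z : E.

Lemma innerDl x y z : inner (x + y) z = inner x z + inner y z.
Proof. by rewrite -{1}[x]scale1r inner_linl mul1r. Qed.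

Lemma inner0l z : inner 0 z = 0.
Proof. by apply: (@addrI _ (inner 0 z)); rewrite -innerDl !addr0. Qed.

Lemma innerZl (a : R) x z : inner (a *: x) z = a * inner x z.
Proof. by rewrite -{1}[a *: x]addr0 inner_linl inner0l addr0. Qed.

Lemma inner_ge0 x : 0 <= inner x x.
Proof. by rewrite inner_norm sqr_ge0. Qed.

Lemma inner_eq0 x : inner x x = 0 -> x = 0.
Proof. by rewrite inner_norm => /eqP; rewrite sqrf_eq0 normr_eq0 => /eqP. Qed.

Lemma innerDr x y z : inner x (y + z) = inner x y + inner x z.
Proof. by rewrite innerC innerDl !(innerC x). Qed.

Lemma innerZr (a : R) x z : inner x (a *: z) = a * inner x z.
Proof. by rewrite innerC innerZl innerC. Qed.

Lemma inner_polar x y :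
  inner x y = 2^-1 * (`|x + y| ^+ 2 - `|x| ^+ 2 - `|y| ^+ 2).
Proof.
rewrite -!inner_norm !(innerDl, innerDr) (innerC y x) addrACA addrC.
by field.
Qed.

End inner_theory.

Section hilbert_sum.
Context (R : realType) (E F : prehilbertType R).

(* The library norm on E * F is the maximum norm; hsum is the Hilbert direct
   sum, with squared norm |x.1|^2 + |x.2|^2. *)
Definition hsum : Type := (E * F)%type.

HB.instance Definition _ := GRing.Lmodule.copy hsum (E * F)%type.

Let ip (x y : hsum) : R := inner x.1 y.1 + inner x.2 y.2.

Let ipC x y : ip x y = ip y x.
Proof. by rewrite /ip innerC (innerC x.2). Qed.

Let ip_linl (a : R) (x y z : hsum) :
  ip (a *: x + y) z = a * ip x z + ip y z.
Proof. by rewrite /ip !inner_linl; ring. Qed.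

Let ip_ge0 x : 0 <= ip x x.
Proof. by rewrite addr_ge0 ?inner_ge0. Qed.

Let ip_eq0 x : ip x x = 0 -> x = 0.
Proof.
case: x => x y /eqP; rewrite /ip/= paddr_eq0 ?inner_ge0//.
by move=> /andP[/eqP/inner_eq0 -> /eqP/inner_eq0 ->].
Qed.

HB.instance Definition _ := Lmodule_hasInner.Build R hsum ipC ip_linl ip_ge0 ip_eq0.

End hilbert_sum.

Section strong_measurability.
Context (R : realType) (T : R).

Definition simple_function (Z : Type) (s : R -> Z) :=
  finite_set (range s) /\ forall z, measurable (s @^-1` [set z]).

(* Bochner measurability on ]0, T[, pointwise everywhere; the almost everywhere
   variant only adds representatives of the same classes. *)
Definition strongly_measurable (Z : topologicalType) (f : R -> Z) :=
  exists2 s : nat -> R -> Z, forall n, simple_function (s n) &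
    forall t, t \in `]0, T[ -> s ^~ t @ \oo --> f t.

Lemma simple_function_map2 (Z1 Z2 Z : Type) (h : Z1 -> Z2 -> Z) s r :
  simple_function s -> simple_function r ->
  simple_function (fun t => h (s t) (r t)).
Proof.
move=> [fs ms] [fr mr]; split.
  apply: (sub_finite_set _ (finite_image2 h fs fr)).
  by move=> _ [t _ <-]; exists (s t) => //; exists (r t).
move=> z.
have -> : (fun t => h (s t) (r t)) @^-1` [set z] =
    \bigcup_(x in range s) \bigcup_(y in range r `&` [set y | h x y = z])
      (s @^-1` [set x] `&` r @^-1` [set y]).
  apply/seteqP; split=> [t /= <-|t [x _] [y [_ /= <-]] [/= -> ->//]].
  by exists (s t) => //; exists (r t).
apply: fin_bigcup_measurable => // x _.
apply: fin_bigcup_measurable; first exact: finite_setIl.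
by move=> y _; exact: measurableI.
Qed.

Lemma simple_function_measurable (s : R -> R) :
  simple_function s -> measurable_fun setT s.
Proof.
move=> [fs ms] _ Y _; rewrite setTI.
have -> : s @^-1` Y = \bigcup_(x in range s `&` Y) (s @^-1` [set x]).
  apply/seteqP; split=> [t /= Yt|t [x [_ Yx]] /= -> //].
  by exists (s t).
by apply: fin_bigcup_measurable => //; exact: finite_setIl.
Qed.

Lemma strongly_measurable_measurable (f : R -> R) :
  strongly_measurable f -> measurable_fun `]0, T[ f.
Proof.
move=> [s ss sf]; apply: (@measurable_fun_cvg _ _ _ _ s) => // n.
exact: measurable_funTS (simple_function_measurable (ss n)).
Qed.

Lemma strongly_measurable_map2 (Z1 Z2 Z : topologicalType)
    (h : Z1 -> Z2 -> Z) (f : R -> Z1) (g : R -> Z2) :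
  continuous (fun z => h z.1 z.2) ->
  strongly_measurable f -> strongly_measurable g ->
  strongly_measurable (fun t => h (f t) (g t)).
Proof.
move=> ch [s ss sf] [r rr rg].
exists (fun n t => h (s n t) (r n t)) => [n|t It].
  exact: simple_function_map2.
apply: (@continuous2_cvg _ _ _ _ _ _ (s^~ t) (r^~ t) h).
- exact: (ch (f t, g t)).
- exact: sf.
- exact: rg.
Qed.

Lemma strongly_measurable_map (Z1 Z : topologicalType) (h : Z1 -> Z)
    (f : R -> Z1) :
  continuous h -> strongly_measurable f -> strongly_measurable (h \o f).
Proof.
move=> ch mf.
apply: (@strongly_measurable_map2 _ _ _ (fun x _ => h x) f f) => // z.
by apply: continuous_comp; [exact: cvg_fst|exact: ch].
Qed.

Lemma strongly_measurable_cst (Z : topologicalType) (z : Z) :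
  strongly_measurable (cst z).
Proof.
exists (fun=> cst z) => [_|t _]; last exact: cvg_cst.
split=> [|y].
  by apply: (sub_finite_set _ (finite_set1 z)) => _ [t _ <-].
by rewrite preimage_cst; case: ifP.
Qed.

End strong_measurability.

Lemma continuous_inner (R : realType) (E : prehilbertType R) :
  continuous (fun z : E * E => inner z.1 z.2).
Proof.
have -> : (fun z : E * E => inner z.1 z.2) =
    (fun z => 2^-1 * (`|z.1 + z.2| ^+ 2 - `|z.1| ^+ 2 - `|z.2| ^+ 2)).
  by apply/funext => z; exact: inner_polar.
move=> z.
have c1 : fst @ z --> z.1 by exact: cvg_fst.
have c2 : snd @ z --> z.2 by exact: cvg_snd.
apply: cvgMr; apply: cvgB; last by apply: cvgM; exact: cvg_norm.
by apply: cvgB; apply: cvgM; apply: cvg_norm => //; exact: cvgD.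
Qed.

Section bochner_L2.
Context (R : realType) (T : R) (E : prehilbertType R).
Local Notation mu := (@lebesgue_measure R).
Implicit Types f g : R -> E.

Let mI : measurable (`]0, T[%classic : set (measurableTypeR R)).
Proof. exact: measurable_itv. Qed.

Definition square_integrable : {pred R -> E} :=
  mem [set f | strongly_measurable T f /\
    (\int[mu]_(t in `]0%R, T[) ((`|f t| ^+ 2)%:E) < +oo)%E].

Lemma square_integrableP f : f \in square_integrable ->
  mu.-integrable `]0, T[ (fun t => (`|f t| ^+ 2)%:E).
Proof.
rewrite inE => -[mf foo]; apply/integrableP; split.
  apply/measurable_EFinP.
  apply: (@measurable_funX _ _ _ _ (fun t => `|f t|)).
  apply: strongly_measurable_measurable.
  by apply: strongly_measurable_map mf; exact: norm_continuous.
under eq_integral => t _ do rewrite gee0_abs ?lee_fin ?sqr_ge0//.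
exact: foo.
Qed.

Lemma integrable_inner f g :
  f \in square_integrable -> g \in square_integrable ->
  mu.-integrable `]0, T[ (fun t => (inner (f t) (g t))%:E).
Proof.
move=> Lf Lg.
have mfg : measurable_fun `]0, T[ (fun t => inner (f t) (g t)).
  apply: strongly_measurable_measurable.
  move: Lf Lg; rewrite !inE => -[mf _] [mg _].
  exact: (strongly_measurable_map2 (@continuous_inner _ _) mf mg).
have ifg : mu.-integrable `]0, T[
    ((fun t => (`|f t| ^+ 2)%:E) \+ (fun t => (`|g t| ^+ 2)%:E))%E.
  by apply: integrableD => //; exact: square_integrableP.
apply: (le_integrable mI _ _ ifg); first exact/measurable_EFinP.
move=> t _; rewrite /= lee_fin.
rewrite (ger0_norm (addr_ge0 (sqr_ge0 _) (sqr_ge0 _))).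
rewrite ler_norml; apply/andP; split.
  have := inner_ge0 (f t + g t).
  rewrite -!inner_norm !(innerDl, innerDr) (innerC (g t) (f t)).
  have := inner_ge0 (f t); have := inner_ge0 (g t); lra.
have := inner_ge0 (f t + (- 1) *: g t).
rewrite -!inner_norm !(innerDl, innerDr) !(innerZl, innerZr) (innerC (g t) (f t)).
have := inner_ge0 (f t); have := inner_ge0 (g t); lra.
Qed.

Lemma square_integrable_submod_closed : submod_closed square_integrable.
Proof.
split=> [|a f g Lf Lg].
  rewrite inE; split; first exact: strongly_measurable_cst.
  by under eq_integral => t _ do rewrite normr0 expr0n/=; rewrite integral0.
have mf : strongly_measurable T f by move: Lf; rewrite inE => -[].
have mg : strongly_measurable T g by move: Lg; rewrite inE => -[].
rewrite inE; split.
  apply: (strongly_measurable_map2 (h := fun x y => a *: x + y)) mf mg.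
  move=> z; apply: cvgD; last exact: cvg_snd.
  by apply: cvgZr; exact: cvg_fst.
have -> : (\int[mu]_(t in `]0%R, T[) ((`|(a *: f + g) t| ^+ 2)%:E) =
    \int[mu]_(t in `]0%R, T[) ((a ^+ 2)%:E * (inner (f t) (f t))%:E +
      ((a *+ 2)%:E * (inner (f t) (g t))%:E + (inner (g t) (g t))%:E)))%E.
  apply: eq_integral => t _; rewrite -!EFinM -!EFinD -inner_norm; congr EFin.
  rewrite !(innerDl, innerDr) !(innerZl, innerZr) (innerC (g t) (f t)) -mulr_natl.
  by ring.
have : mu.-integrable `]0, T[ (fun t => ((a ^+ 2)%:E * (inner (f t) (f t))%:E +
      ((a *+ 2)%:E * (inner (f t) (g t))%:E + (inner (g t) (g t))%:E))%E).
  apply: integrableD => //; first by apply: integrableZl => //; exact: integrable_inner.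
  apply: integrableD => //; last exact: integrable_inner.
  by apply: integrableZl => //; exact: integrable_inner.
by move/integrable_lty; apply.
Qed.

HB.instance Definition _ := GRing.isSubmodClosed.Build R (R -> E)
  square_integrable square_integrable_submod_closed.

(* The functions of which L2 T E consists of the almost everywhere classes. *)
Record L2fun := MkL2fun {
  L2fun_val :> R -> E;
  L2fun_prop : L2fun_val \in square_integrable }.

HB.instance Definition _ := [isSub for L2fun_val].
HB.instance Definition _ := [Choice of L2fun by <:].
HB.instance Definition _ := [SubChoice_isSubLmodule of L2fun by <:].

Definition ae_zero : {pred L2fun} :=
  mem [set f : L2fun | \forall t \ae mu, t \in `]0, T[ -> f t = 0].

Lemma ae_zero_zmod_closed : zmod_closed ae_zero.
Proof.
split; first by rewrite inE; exact: aeW.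
move=> f g; rewrite !inE => f0 g0.
have FF := @ae_filter_ringOfSetsType _ _ _ mu.
apply: filterS2 f0 g0 => t ft gt It.
have : f t - g t = 0 by rewrite (ft It) (gt It) subrr.
exact.
Qed.

HB.instance Definition _ := GRing.isZmodClosed.Build L2fun ae_zero
  ae_zero_zmod_closed.

Definition L2 : Type := Quotient.quot ae_zero.
HB.instance Definition _ := GRing.Zmodule.on L2.
HB.instance Definition _ := EqQuotient.on L2.

(* A chosen representative; it is determined up to a null set only. *)
Definition L2_fun (u : L2) : R -> E := L2fun_val (repr u).

Local Open Scope quotient_scope.

Lemma L2_fun_in (u : L2) : L2_fun u \in square_integrable.
Proof. exact: L2fun_prop. Qed.

Lemma L2_funE (f : L2fun) :
  \forall t \ae mu, t \in `]0, T[ -> L2_fun (\pi_L2 f) t = f t.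
Proof.
have FF := @ae_filter_ringOfSetsType _ _ _ mu.
have : repr (\pi_L2 f) - f \in ae_zero.
  by rewrite Quotient.idealrBE reprK.
rewrite inE; apply: filterS => t H It.
by apply/eqP; rewrite -subr_eq0; apply/eqP; exact: H.
Qed.

Lemma L2_eqP (u v : L2) :
  (\forall t \ae mu, t \in `]0, T[ -> L2_fun u t = L2_fun v t) -> u = v.
Proof.
have FF := @ae_filter_ringOfSetsType _ _ _ mu.
move=> uv; rewrite -[u]reprK -[v]reprK; apply/eqP.
rewrite -Quotient.idealrBE inE; apply: filterS uv => t H It.
have : L2_fun u t - L2_fun v t = 0 by rewrite (H It) subrr.
exact.
Qed.

Definition L2_scale (a : R) (u : L2) : L2 := \pi_L2 (a *: repr u).

Lemma L2_scaleE (a : R) (f : L2fun) : L2_scale a (\pi_L2 f) = \pi_L2 (a *: f).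
Proof.
have FF := @ae_filter_ringOfSetsType _ _ _ mu.
apply/eqP; rewrite -Quotient.idealrBE -scalerBr inE.
apply: filterS (L2_funE f) => t H It.
have : a *: (L2_fun (\pi_L2 f) t - f t) = 0 by rewrite (H It) subrr scaler0.
exact.
Qed.

Let scaleA a b u : L2_scale a (L2_scale b u) = L2_scale (a * b) u.
Proof. by rewrite [L2_scale b u]/L2_scale L2_scaleE scalerA. Qed.

Let scale1 : left_id 1 L2_scale.
Proof. by move=> u; rewrite /L2_scale scale1r reprK. Qed.

Let scaleDr : right_distributive L2_scale +%R.
Proof.
move=> a u v; rewrite -{1}[u]reprK -{1}[v]reprK -pi_addr L2_scaleE.
by rewrite scalerDr pi_addr.
Qed.

Let scaleDl u : {morph L2_scale^~ u : a b / a + b}.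
Proof. by move=> a b; rewrite /L2_scale scalerDl pi_addr. Qed.

HB.instance Definition _ :=
  GRing.Zmodule_isLmodule.Build R L2 scaleA scale1 scaleDr scaleDl.

Lemma L2_fun_lin (a : R) (u v : L2) : \forall t \ae mu, t \in `]0, T[ ->
  L2_fun (a *: u + v) t = a *: L2_fun u t + L2_fun v t.
Proof.
have FF := @ae_filter_ringOfSetsType _ _ _ mu.
have -> : a *: u + v = \pi_L2 (a *: repr u + repr v).
  by rewrite [in LHS]/GRing.scale/= /L2_scale -{1}[v]reprK pi_addr.
by apply: filterS (L2_funE (a *: repr u + repr v)) => t H It; rewrite (H It).
Qed.

Definition L2_inner (u v : L2) : R :=
  \int[mu]_(t in `]0, T[) inner (L2_fun u t) (L2_fun v t).

Let ipC u v : L2_inner u v = L2_inner v u.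
Proof. by apply: eq_Rintegral => t _; rewrite innerC. Qed.

Let ip_linl (a : R) (u v w : L2) :
  L2_inner (a *: u + v) w = a * L2_inner u w + L2_inner v w.
Proof.
have FF := @ae_filter_ringOfSetsType _ _ _ mu.
have iuw := integrable_inner (L2_fun_in u) (L2_fun_in w).
have ivw := integrable_inner (L2_fun_in v) (L2_fun_in w).
have iauw : mu.-integrable `]0, T[
    (fun t => (a * inner (L2_fun u t) (L2_fun w t))%:E).
  exact: (integrableZl mI a iuw).
rewrite /L2_inner -RintegralZl// -RintegralD//.
congr fine; apply: ae_eq_integral => //.
- by apply: measurable_int; exact: integrable_inner (L2_fun_in _) (L2_fun_in _).
- have := integrableD mI iauw ivw; apply: measurable_int.
apply: filterS (L2_fun_lin a u v) => t H It.
by rewrite H// inner_linl.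
Qed.

Let ip_ge0 u : 0 <= L2_inner u u.
Proof. by apply: Rintegral_ge0 => t _; exact: inner_ge0. Qed.

Let ip_eq0 u : L2_inner u u = 0 -> u = 0.
Proof.
have FF := @ae_filter_ringOfSetsType _ _ _ mu.
have iu := integrable_inner (L2_fun_in u) (L2_fun_in u).
move=> u0.
have : (\int[mu]_(t in `]0%R, T[) `|(inner (L2_fun u t) (L2_fun u t))%:E| = 0)%E.
  under eq_integral => t _ do rewrite gee0_abs ?lee_fin ?inner_ge0//.
  rewrite -[LHS]fineK; last exact: integrable_fin_num.
  by congr EFin; exact: u0.
move/(ae_eq_integral_abs _ mI (measurable_int _ iu)) => H.
apply: L2_eqP.
have z := L2_funE 0.
have <- : \pi_L2 0 = 0 :> L2 by rewrite pi_zeror.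
apply: filterS2 z H => t zt Ht It; rewrite (zt It).
have [iu0] := Ht It.
by have := inner_eq0 iu0.
Qed.

HB.instance Definition _ :=
  Lmodule_hasInner.Build R L2 ipC ip_linl ip_ge0 ip_eq0.

End bochner_L2.

Arguments square_integrable {R} T E.
Arguments L2 {R} T E.

Section L2_class.
Context (R : realType) (T : R) (E : prehilbertType R).
Local Notation mu := (@lebesgue_measure R).

Definition represents (w : L2 T E) (h : R -> E) :=
  \forall t \ae mu, t \in `]0, T[ -> L2_fun w t = h t.

(* The class of h; it is 0 if no square integrable function represents h. *)
Definition L2_of (h : R -> E) : L2 T E := xget 0 [set w | represents w h].
End L2_class.

(* Extended real valued, so that an unbounded operator has norm +oo. *)
Definition opnorm (R : realType) (E F : normedModType R) (L : E -> F) : \bar R :=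
  ereal_sup [set `|L x|%:E | x in [set x | `|x| <= 1]].

(* Us is the dual of U: pairing is an isometry of Us onto the continuous linear
   functionals of U with the dual norm, which determines the inner product of
   Us. The embedding of H into Us maps h to inner h (emb _). *)
Record gelfand_triple (R : realType) (U H Us : hilbertType R) := GelfandTriple {
  emb : {linear U -> H};
  emb_continuous : continuous emb;
  emb_injective : injective emb;
  emb_dense : dense (range emb);
  pairing : Us -> {linear U -> R^o};
  pairing_linl : forall (a : R) (s s' : Us) (v : U),
    pairing (a *: s + s') v = a * pairing s v + pairing s' v;
  pairing_norm : forall s : Us, `|s|%:E = opnorm (pairing s);
  pairing_onto : forall l : {linear U -> R^o}, continuous l ->
    exists s : Us, pairing s =1 l
}.

Definition test_function (R : realType) (T : R) (phi : R -> R) :=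
  (forall n x, derivable (derive1n n (phi : R -> R^o)) x 1) /\
  exists a b : R, [/\ 0 < a, b < T & forall t, t \notin `[a, b] -> phi t = 0].

Lemma pairing_bound (R : realType) (U H Us : hilbertType R)
    (G : gelfand_triple U H Us) (s : Us) (v : U) :
  `|pairing G s v| <= `|s| * `|v|.
Proof.
have [->|v0] := eqVneq v 0; first by rewrite linear0 !normr0 mulr0.
have nv : 0 < `|v| by rewrite normr_gt0.
have : (`|pairing G s (`|v|^-1 *: v)|%:E <= `|s|%:E)%E.
  rewrite (pairing_norm G); apply: ereal_sup_ubound.
  exists (`|v|^-1 *: v) => //=.
  by rewrite normrZ ger0_norm ?invr_ge0// mulVf ?gt_eqF.
rewrite lee_fin linearZ/= normrM ger0_norm ?invr_ge0//.
by rewrite mulrC ler_pdivrMr.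
Qed.

Lemma test_function_continuous (R : realType) (T : R) (phi : R -> R) (n : nat) :
  test_function T phi -> continuous (derive1n n (phi : R -> R^o)).
Proof.
move=> [dphi _] x; apply: differentiable_continuous.
exact/derivable1_diffP.
Qed.

Lemma integrable_test (R : realType) (T : R) (E : prehilbertType R)
    (l : {linear E -> R^o}) (f : R -> E) (psi : R -> R) :
  continuous l -> f \in square_integrable T E -> continuous psi ->
  (@lebesgue_measure R).-integrable `]0, T[ (fun t => (l (f t) * psi t)%:E).
Proof.
move=> cl Lf cpsi.
have mf : strongly_measurable T f by move: Lf; rewrite inE => -[].
have [C C0 lC] : exists2 C : R, 0 < C & forall x, `|l x| <= C * `|x|.
  have /linear_bounded_continuous/linear_boundedP/pinfty_ex_gt0[C C0 lC] := cl.
  by exists C.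
have [B B0 psiB] : exists2 B : R, 0 <= B & forall t, t \in `]0, T[ -> `|psi t| <= B.
  have [T0|T0] := leP 0 T; last first.
    exists 0 => // t; rewrite in_itv/= => /andP[t0 tT].
    by have := lt_trans t0 (lt_trans tT T0); rewrite ltxx.
  have cn : {within `[0, T], continuous (fun t => `|psi t|)}.
    apply: continuous_subspaceT => x.
    by apply: continuous_comp; [exact: cpsi|exact: norm_continuous].
  have [c _ cmax] := EVT_max T0 cn.
  exists `|psi c| => // t It; apply: cmax.
  by move: It; rewrite !in_itv/= => /andP[/ltW -> /ltW ->].
have mI : measurable (`]0, T[%classic : set (measurableTypeR R)).
  exact: measurable_itv.
have i1 : (@lebesgue_measure R).-integrable `]0, T[ (fun=> 1%:E).
  apply/integrableP; split; first exact: measurable_cst.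
  under eq_integral => t _ do rewrite abse1.
  rewrite integral_cst// mul1e [X in (X < _)%E]lebesgue_measure_itv/=.
  by case: ifP => // _; rewrite -EFinD ltry.
have i2 := integrableZl mI (C * B) (integrableD mI i1 (square_integrableP Lf)).
have m1 : measurable_fun `]0, T[ (fun t => l (f t) : R).
  exact: strongly_measurable_measurable (strongly_measurable_map cl mf).
have m2 : measurable_fun `]0, T[ psi.
  apply: measurable_funTS. apply: continuous_measurable_fun. exact: cpsi.
apply: (le_integrable mI _ _ i2).
  exact/measurable_EFinP/measurable_funM.
move=> t It; rewrite /= lee_fin normrM.
rewrite [leRHS]ger0_norm; last first.
  by rewrite mulr_ge0 ?addr_ge0 ?sqr_ge0// mulr_ge0// ltW.
have h1 := lC (f t); have h2 := psiB t It.
apply: (@le_trans _ _ (C * `|f t| * B)).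
  by apply: ler_pM.
rewrite mulrAC ler_wpM2l ?mulr_ge0 ?(ltW C0)//.
have := sqr_ge0 (`|f t| - 1); have := normr_ge0 (f t); nra.
Qed.

Section state_space.
Context (R : realType) (U H Us : hilbertType R).
Variables (G : gelfand_triple U H Us) (T : R).
Local Notation mu := (@lebesgue_measure R).

(* w = du/dt in the sense of U^*-valued distributions on ]0, T[, where u(t) is
   regarded as the functional inner (emb (u t)) (emb _); the identity in U^* is
   tested on every v in U. *)
Definition weak_derivative (u : L2 T U) (w : L2 T Us) :=
  forall (v : U) (phi : R -> R), test_function T phi ->
    \int[mu]_(t in `]0, T[) (pairing G (L2_fun w t) v * phi t) =
    - \int[mu]_(t in `]0, T[)
        (inner (emb G (L2_fun u t)) (emb G v) * derive1 (phi : R -> R^o) t).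

Definition weak_graph : {pred hsum (L2 T U) (L2 T Us)} :=
  mem [set p : hsum _ _ | weak_derivative p.1 p.2].

Lemma Rintegral_L2_lin (E : prehilbertType R) (l : {linear E -> R^o})
    (psi : R -> R) (a : R) (x y : L2 T E) :
  continuous l -> continuous psi ->
  \int[mu]_(t in `]0, T[) (l (L2_fun (a *: x + y) t) * psi t) =
  a * \int[mu]_(t in `]0, T[) (l (L2_fun x t) * psi t) +
  \int[mu]_(t in `]0, T[) (l (L2_fun y t) * psi t).
Proof.
have FF := @ae_filter_ringOfSetsType _ _ _ mu.
move=> cl cpsi.
have mI : measurable (`]0, T[%classic : set (measurableTypeR R)).
  exact: measurable_itv.
have ix := integrable_test cl (L2_fun_in x) cpsi.
have iy := integrable_test cl (L2_fun_in y) cpsi.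
have iax := integrableZl mI a ix.
rewrite -RintegralZl// -RintegralD//.
congr fine; apply: ae_eq_integral => //.
- by apply: measurable_int; exact: integrable_test (L2_fun_in _) cpsi.
- have := integrableD mI iax iy; apply: measurable_int.
apply: filterS (L2_fun_lin a x y) => t Ht It.
by rewrite (Ht It) linearP/= mulrDl -mulrA.
Qed.

Lemma pairing_functional (v : U) : exists2 l : {linear Us -> R^o},
  continuous l & forall s, l s = pairing G s v.
Proof.
have pl : linear (fun s => pairing G s v : R^o).
  by move=> a s s'; exact: pairing_linl.
pose l : {linear Us -> R^o} := HB.pack (fun s => pairing G s v : R^o)
  (GRing.isLinear.Build R Us R^o *:%R (fun s => pairing G s v : R^o) pl).
exists l => //.
apply/linear_bounded_continuous/linear_boundedP.
near=> r => s; apply: (le_trans (pairing_bound G s v)).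
rewrite mulrC ler_wpM2r//; near: r; exact: nbhs_pinfty_ge.
Unshelve. all: by end_near. Qed.

Lemma emb_functional (v : U) : exists2 l : {linear U -> R^o},
  continuous l & forall x, l x = inner (emb G x) (emb G v).
Proof.
have pl : linear (fun x => inner (emb G x) (emb G v) : R^o).
  by move=> a x y; rewrite linearP inner_linl.
pose l : {linear U -> R^o} := HB.pack (fun x => inner (emb G x) (emb G v) : R^o)
  (GRing.isLinear.Build R U R^o *:%R
    (fun x => inner (emb G x) (emb G v) : R^o) pl).
exists l => // x.
apply: (@continuous2_cvg _ _ _ _ _ _ _ _ (fun x y : H => inner x y : R^o)).
- exact: (@continuous_inner _ H (emb G x, emb G v)).
- exact: emb_continuous.
- exact: cvg_cst.
Qed.

Lemma weak_graph_submod_closed : submod_closed weak_graph.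
Proof.
have lin (a : R) (x y : hsum (L2 T U) (L2 T Us)) v phi : test_function T phi ->
    \int[mu]_(t in `]0, T[) (pairing G (L2_fun (a *: x + y).2 t) v * phi t) =
    a * \int[mu]_(t in `]0, T[) (pairing G (L2_fun x.2 t) v * phi t) +
    \int[mu]_(t in `]0, T[) (pairing G (L2_fun y.2 t) v * phi t) /\
    \int[mu]_(t in `]0, T[) (inner (emb G (L2_fun (a *: x + y).1 t)) (emb G v) *
      derive1 (phi : R -> R^o) t) =
    a * \int[mu]_(t in `]0, T[) (inner (emb G (L2_fun x.1 t)) (emb G v) *
      derive1 (phi : R -> R^o) t) +
    \int[mu]_(t in `]0, T[) (inner (emb G (L2_fun y.1 t)) (emb G v) *
      derive1 (phi : R -> R^o) t).
  move=> tphi.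
  have c0 := @test_function_continuous R T phi 0%N tphi.
  have c1 := @test_function_continuous R T phi 1%N tphi.
  have [l cl lE] := pairing_functional v.
  have [k ck kE] := emb_functional v.
  have := Rintegral_L2_lin a x.2 y.2 cl c0.
  have := Rintegral_L2_lin a x.1 y.1 ck c1.
  have rl (w : L2 T Us) : \int[mu]_(t in `]0, T[) (l (L2_fun w t) * phi t) =
      \int[mu]_(t in `]0, T[) (pairing G (L2_fun w t) v * phi t).
    by apply: eq_Rintegral => t _; rewrite lE.
  have rk (w : L2 T U) :
      \int[mu]_(t in `]0, T[) (k (L2_fun w t) * derive1 (phi : R -> R^o) t) =
      \int[mu]_(t in `]0, T[) (inner (emb G (L2_fun w t)) (emb G v) *
        derive1 (phi : R -> R^o) t).
    by apply: eq_Rintegral => t _; rewrite kE.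
  by rewrite !rl !rk => -> ->.
have wl (a : R) x y : x \in weak_graph -> y \in weak_graph ->
    a *: x + y \in weak_graph.
  rewrite !inE => wx wy v phi tphi.
  have [-> ->] := lin a x y v phi tphi.
  by rewrite (wx v phi tphi) (wy v phi tphi) mulrN opprD.
split=> //; rewrite inE => v phi tphi.
have [] := lin (-1) 0 0 v phi tphi.
rewrite scaler0 addr0 !mulN1r !addNr => -> ->; exact/esym/oppr0.
Qed.

HB.instance Definition _ := GRing.isSubmodClosed.Build R _
  weak_graph weak_graph_submod_closed.

(* The space of u in L^2(0, T; U) with derivative u' in L^2(0, T; U^* ), with
   squared norm |u|^2 + |u'|^2. An element is the pair (u, u'): as u' is
   determined by u, the pair carries the same data as u. *)
Record state := MkState {
  state_val : hsum (L2 T U) (L2 T Us);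
  state_prop : state_val \in weak_graph }.

HB.instance Definition _ := [isSub for state_val].
HB.instance Definition _ := [Choice of state by <:].
HB.instance Definition _ := [SubChoice_isSubLmodule of state by <:].

Let ip (u v : state) : R := inner (state_val u) (state_val v).

Let ipC u v : ip u v = ip v u. Proof. exact: innerC. Qed.

Let ip_linl (a : R) (u v w : state) : ip (a *: u + v) w = a * ip u w + ip v w.
Proof. exact: inner_linl. Qed.

Let ip_ge0 u : 0 <= ip u u. Proof. exact: inner_ge0. Qed.

Let ip_eq0 u : ip u u = 0 -> u = 0.
Proof. by move=> u0; apply: val_inj; exact: (inner_eq0 u0). Qed.

HB.instance Definition _ :=
  Lmodule_hasInner.Build R state ipC ip_linl ip_ge0 ip_eq0.

Definition state_fun (u : state) : R -> U := L2_fun (state_val u).1.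

Definition time_derivative (u : state) : L2 T Us := (state_val u).2.

(* u(0) for the representative of u that is continuous with values in H. That
   representative exists and is unique for 0 < T; xget needs a default value
   because neither fact is proved here. *)
Definition trace0 (u : state) : H :=
  xget 0 [set h | exists c : R -> H, [/\ {within `[0, T], continuous c},
    \forall t \ae mu, t \in `]0, T[ -> c t = emb G (state_fun u t) &
    c 0 = h]].

End state_space.

(* Measurable in t up to a null set, continuous in (x, u) for almost every t. *)
Definition caratheodory (R : realType) (T : R)
    (X U : normedModType R) (Us : normedModType R) (f : R -> X -> U -> Us) :=
  (forall x u, exists2 g : R -> Us, strongly_measurable T g &
    \forall t \ae (@lebesgue_measure R), t \in `]0, T[ -> g t = f t x u) /\
  \forall t \ae (@lebesgue_measure R), t \in `]0, T[ ->
    continuous (fun z : X * U => f t z.1 z.2).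

Section all_at_once.
Context (R : realType) (X U H Us : hilbertType R).
Variables (G : gelfand_triple U H Us) (T : R) (A : X -> H)
  (f : R -> X -> U -> Us).

Definition nemytskii_defined := forall (x : X) (u : state G T),
  exists w : L2 T Us, represents w (fun t => f t x (state_fun u t)).

Definition nemytskii (x : X) (u : state G T) : L2 T Us :=
  L2_of T (fun t => f t x (state_fun u t)).

Definition all_at_once (x : X) (u : state G T) : hsum (L2 T Us) H :=
  (time_derivative u + nemytskii x u, A x - trace0 u).
End all_at_once.

(* The Hilbert space adjoint, which exists for continuous linear L if E is
   complete. *)
Definition adjoint (R : realType) (E F : prehilbertType R) (L : E -> F) : F -> E :=
  xget (fun=> 0) [set L' | forall x y, inner (L x) y = inner x (L' y)].

(* Main.v *)
Require Import Defs.
From mathcomp Require Import all_boot all_order all_algebra.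
From mathcomp Require Import all_classical all_reals all_analysis.
From mathcomp Require Import ring lra.
Set Implicit Arguments.
Unset Strict Implicit.
Unset Printing Implicit Defensive.
Import Order.TTheory GRing.Theory Num.Theory.
Import numFieldNormedType.Exports.
Local Open Scope classical_set_scope.
Local Open Scope ring_scope.

(** The proof follows the distance to the solution [us] rather than the residual
    itself.  Write [a] for the residual at [u], [K] for the derivative at [u] and
    [u' = u - K^* a] for the next iterate.  Expanding the square,
      |u' - us|^2 = |u - us|^2 - 2 (a, K (u - us)) + |K^* a|^2
                 <= |u - us|^2 - mu |a|^2,
    because the tangential condition bounds 2 (a, K (u - us)) from below by
    (M^2 + mu) |a|^2 and |K^* a| <= M |a| ([landweber_step_dist]).  So
    the iterates stay in the ball of radius r / 2 about [us], hence in the ball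
    of radius r in which all the conditions hold, and coercivity improves
    the estimate to |u' - us|^2 <= (C^2 - mu) |a|^2.

    The residual is then recovered from the distance: as the derivative is bounded
    by M on the convex ball, the mean value inequality ([lipschitz_on_ball])
    gives |F u' - F us|^2 <= M^2 |u' - us|^2 <= M^2 (C^2 - mu) |a|^2, and the
    factor M^2 (C^2 - mu) is at most 1 under the smallness condition on C, M and
    mu ([contraction_factor_le1]).

    All this happens in plain inner product spaces ([landweber_residual_decr]).
    The adjoint identity used in the first estimate comes from injectivity: where
    the derivative has no adjoint, [adjoint] is the zero map, which is injective
    only on a trivial space ([adjoint_innerE]). *)

Section inner_product.
Context (R : realType) (E : prehilbertType R).
Implicit Types x y z : E.

Lemma innerNl x z : inner (- x) z = - inner x z.
Proof. by rewrite -scaleN1r innerZl mulN1r. Qed.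

Lemma innerBl x y z : inner (x - y) z = inner x z - inner y z.
Proof. by rewrite innerDl innerNl. Qed.

Lemma innerBr x y z : inner x (y - z) = inner x y - inner x z.
Proof. by rewrite innerC innerBl !(innerC x). Qed.

Lemma normB_sqr x y :
  `|x - y| ^+ 2 = `|x| ^+ 2 - 2 * inner x y + `|y| ^+ 2.
Proof. by rewrite -!inner_norm innerBl !innerBr (innerC y x); ring. Qed.

Lemma inner_le_norm x y : inner x y <= `|x| * `|y|.
Proof.
have [->|x0] := eqVneq x 0; first by rewrite inner0l normr0 mul0r.
have [->|y0] := eqVneq y 0; first by rewrite innerC inner0l normr0 mulr0.
have xgt0 : 0 < `|x| by rewrite normr_gt0.
have ygt0 : 0 < `|y| by rewrite normr_gt0.
(* Both vectors are rescaled to the common length |x| |y|. *)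
have := sqr_ge0 `|(`|y| *: x - `|x| *: y)|.
rewrite normB_sqr innerZl innerZr !normrZ !normr_id => h.
have {}h : 0 <= `|x| * `|y| * (`|x| * `|y| - inner x y) by nra.
by move: h; rewrite pmulr_rge0 ?mulr_gt0// subr_ge0.
Qed.

End inner_product.

Lemma opnorm_le_bound (R : realType) (E W : normedModType R)
    (L : {linear E -> W}) (M : R) :
  (opnorm L <= M%:E)%E -> forall x, `|L x| <= M * `|x|.
Proof.
move=> LM x; have [->|x0] := eqVneq x 0; first by rewrite linear0 !normr0 mulr0.
have nx : 0 < `|x| by rewrite normr_gt0.
have : (`|L (`|x|^-1 *: x)|%:E <= M%:E)%E.
  apply: le_trans LM; apply: ereal_sup_ubound.
  exists (`|x|^-1 *: x) => //=.
  by rewrite normrZ ger0_norm ?invr_ge0// mulVf ?gt_eqF.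
rewrite lee_fin linearZ/= normrZ ger0_norm ?invr_ge0//.
by rewrite mulrC ler_pdivrMr.
Qed.

(** If no map satisfies the adjoint identity, [adjoint L] is the zero map, which
    is injective only when [W] is trivial; the identity then holds anyway. *)
Lemma adjoint_innerE (R : realType) (E W : prehilbertType R)
    (L : E -> W) : injective (adjoint L) ->
  forall x y, inner (L x) y = inner x (adjoint L y).
Proof.
rewrite /adjoint; case: xgetP => [L' _ //|_ inj x y].
by rewrite (inj y 0 erefl) !(innerC _ 0) !inner0l.
Qed.

Lemma adjoint_norm_le (R : realType) (E W : prehilbertType R)
    (L : {linear E -> W}) (L' : W -> E) (M : R) :
  (forall x y, inner (L x) y = inner x (L' y)) -> 0 <= M ->
  (opnorm L <= M%:E)%E -> forall y, `|L' y| <= M * `|y|.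
Proof.
move=> adj M0 LM y; have [->|y0] := eqVneq (L' y) 0; first by rewrite normr0 mulr_ge0.
have ngt0 : 0 < `|L' y| by rewrite normr_gt0.
rewrite -(ler_pM2l ngt0) -expr2 -inner_norm -adj.
apply: le_trans (inner_le_norm _ _) _.
by rewrite mulrCA mulrA ler_wpM2r// opnorm_le_bound.
Qed.

Lemma segment_in_ball (R : realType) (E : normedModType R) (c u v : E) (r t : R) :
  `|c - u| <= r -> `|c - v| <= r -> 0 <= t <= 1 -> `|c - (v + t *: (u - v))| <= r.
Proof.
move=> cu cv /andP[t0 t1].
have -> : c - (v + t *: (u - v)) = t *: (c - u) + (1 - t) *: (c - v).
  rewrite scalerBl scale1r addrCA -scalerBr opprB [c - u + _]addrC subrKA.
  by rewrite opprD addrA -scalerN opprB.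
apply: le_trans (ler_normD _ _) _; rewrite !normrZ !ger0_norm ?subr_ge0//.
by nra.
Qed.

Lemma is_derive_inner_line (R : realType) (E W : prehilbertType R)
    (F : E -> W) (v w : E) (y : W) (t : R) :
  differentiable F (v + t *: w) ->
  is_derive t (1 : R) (fun s : R => inner (F (v + s *: w)) y)
    (inner ('d F (v + t *: w) w) y).
Proof.
move=> dF.
suff h : h^-1 *: (((fun s : R => inner (F (v + s *: w)) y) \o shift t) (h *: 1)
    - inner (F (v + t *: w)) y) @[h --> 0^'] --> inner ('d F (v + t *: w) w) y.
  by apply: DeriveDef; [apply/cvg_ex; exists (inner ('d F (v + t *: w) w) y)
                       |apply/cvg_lim].
have dw : h^-1 *: ((F \o shift (v + t *: w)) (h *: w) - F (v + t *: w))
    @[h --> 0^'] --> 'd F (v + t *: w) w.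
  by rewrite -deriveE//; exact: diff_derivable.
pose q (h : R) := h^-1 *: ((F \o shift (v + t *: w)) (h *: w) - F (v + t *: w)).
have : inner (q h) y @[h --> 0^'] --> inner ('d F (v + t *: w) w) y.
  apply: (@continuous2_cvg _ _ _ _ _ _ q (fun=> y) (fun a b : W => inner a b)).
  - exact: (@continuous_inner _ W (_, _)).
  - exact: dw.
  - exact: cvg_cst.
apply: cvg_trans; apply: near_eq_cvg; near=> h.
rewrite /q/= innerZl innerBl; congr (_ * (inner (F _) y - _)).
by rewrite [h *: 1]mulr1 scalerDl addrCA.
Unshelve. all: by end_near. Qed.

(** Mean value inequality, reduced to real functions by pairing the increment
    [F u - F v] with itself along the segment. *)
Lemma lipschitz_on_ball (R : realType) (E W : prehilbertType R)
    (F : E -> W) (c : E) (r M : R) :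
  (forall x, differentiable F x) ->
  (forall x, `|c - x| <= r -> (opnorm ('d F x) <= M%:E)%E) ->
  forall u v, `|c - u| <= r -> `|c - v| <= r -> `|F u - F v| <= M * `|u - v|.
Proof.
move=> dF FM u v cu cv.
pose y := F u - F v; pose g s := inner (F (v + s *: (u - v))) y.
have dg (t : R) : is_derive t (1 : R) g (inner ('d F (v + t *: (u - v)) (u - v)) y).
  exact: is_derive_inner_line.
have cg : {within `[0, 1], continuous g}.
  by apply: derivable_within_continuous => t _; apply: ex_derive.
have [t t01] := MVT ltr01 (fun t _ => dg t) cg.
rewrite subr0 mulr1 /g scale1r scale0r addr0 [v + _]addrC subrK -innerBl inner_norm => gE.
have {}t01 : 0 <= t <= 1.
  by move: t01; rewrite in_itv/= => /andP[/ltW -> /ltW ->].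
have bt := opnorm_le_bound (FM _ (segment_in_ball cu cv t01)) (u - v).
have : `|y| ^+ 2 <= M * `|u - v| * `|y|.
  by rewrite gE; apply: le_trans (inner_le_norm _ _) _; rewrite ler_wpM2r.
have [y0 _|y0] := eqVneq y 0; last by rewrite expr2 ler_pM2r// normr_gt0.
by rewrite -/y y0 normr0; apply: le_trans bt.
Qed.

Lemma landweber_step_dist (R : realType) (E W : prehilbertType R)
    (L : {linear E -> W}) (L' : W -> E) (e : E) (a : W)
    (M mu : R) :
  (forall x y, inner (L x) y = inner x (L' y)) ->
  0 <= M -> (opnorm L <= M%:E)%E ->
  (M ^+ 2 + mu) * `|a| ^+ 2 <= 2 * inner a (L e) ->
  `|e - L' a| ^+ 2 <= `|e| ^+ 2 - mu * `|a| ^+ 2.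
Proof.
move=> adj M0 LM tang; rewrite normB_sqr -adj innerC.
have : `|L' a| ^+ 2 <= (M * `|a|) ^+ 2.
  by rewrite ler_pXn2r ?nnegrE ?mulr_ge0// (adjoint_norm_le adj).
by rewrite exprMn; lra.
Qed.

(** When C M > 1, the hypothesis gives
    M^2 mu > (C M)^2 (C^2 M^2 - 1) >= C^2 M^2 - 1. *)
Lemma contraction_factor_le1 (R : realFieldType) (C M mu : R) :
  0 < mu -> C ^+ 2 * (C ^+ 2 * M ^+ 2 - 1) < mu ->
  M ^+ 2 * (C ^+ 2 - mu) <= 1.
Proof.
move=> mu0 small; have M0 := sqr_ge0 M.
have [CM|CM] := leP (C ^+ 2 * M ^+ 2) 1; first by nra.
have : M ^+ 2 * (C ^+ 2 * (C ^+ 2 * M ^+ 2 - 1)) <= M ^+ 2 * mu.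
  by rewrite ler_wpM2l// ltW.
have : 0 <= (C ^+ 2 * M ^+ 2 - 1) ^+ 2 by exact: sqr_ge0.
by nra.
Qed.

(** Solution and first iterate are both at distance at most [r / 2], so that the
    iterates, whose distance to [us] does not grow, never leave the ball of
    radius [r] about [c] to which the conditions on [F] are restricted. *)
Lemma landweber_residual_decr (R : realType) (E W : prehilbertType R)
    (F : E -> W) (c us : E) (y : W) (u_ : nat -> E) (r M mu C : R) :
  (forall x, differentiable F x) -> 0 <= r -> 0 <= M -> 0 < mu -> 0 <= C ->
  (forall u v, `|c - u| <= r -> `|c - v| <= r ->
    [/\ (opnorm ('d F u) <= M%:E)%E,
        (M ^+ 2 + mu) * `|F u - F v| ^+ 2 <=
          2 * inner (F u - F v) ('d F u (u - v)) &
        `|u - v| <= C * `|F u - F v|]) ->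
  `|c - us| <= r / 2 -> F us = y -> `|us - u_ 0%N| <= r / 2 ->
  (forall k, u_ k.+1 = u_ k - adjoint ('d F (u_ k)) (F (u_ k) - y)) ->
  (forall k, injective (adjoint ('d F (u_ k)))) ->
  C ^+ 2 * (C ^+ 2 * M ^+ 2 - 1) < mu ->
  forall k, `|F (u_ k.+1) - y| <= `|F (u_ k) - y|.
Proof.
move=> dF r0 M0 mu0 C0 cond us_near Fus u0_near uS inj small.
have in_ball v : `|us - v| <= r / 2 -> `|c - v| <= r.
  move=> usv; rewrite -(subrKA us) [leRHS]splitr.
  by apply: le_trans (ler_normD _ _) _; rewrite lerD.
have us_ball : `|c - us| <= r by apply: in_ball; rewrite subrr normr0 divr_ge0.
have dist k : `|us - u_ k| <= r / 2 ->
    `|u_ k.+1 - us| ^+ 2 <= `|u_ k - us| ^+ 2 - mu * `|F (u_ k) - y| ^+ 2.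
  move=> uk; have [KM tang _] := cond _ _ (in_ball _ uk) us_ball.
  rewrite uS addrAC; apply: landweber_step_dist KM _ => //.
    exact: adjoint_innerE.
  by rewrite -Fus.
have iter_near k : `|us - u_ k| <= r / 2.
  elim: k => [//|k uk]; apply: le_trans (uk).
  rewrite !(distrC us) -(@ler_pXn2r _ 2)// ?nnegrE//.
  apply: le_trans (dist _ uk) _.
  by rewrite lerBlDr lerDl mulr_ge0 ?sqr_ge0// ltW.
move=> k; have [_ _] := cond _ _ (in_ball _ (iter_near k)) us_ball.
rewrite Fus => coe.
have lip : `|F (u_ k.+1) - y| <= M * `|u_ k.+1 - us|.
  rewrite -Fus; apply: (lipschitz_on_ball dF (c := c) (r := r)) => //.
    by move=> x xr; have [] := cond _ _ xr us_ball.
  exact: in_ball.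
have distk := dist k (iter_near k).
(* The distance decrease is quadratic, so all three bounds are squared first. *)
rewrite -(@ler_pXn2r _ 2)// ?nnegrE//.
rewrite -(@ler_pXn2r _ 2) ?nnegrE ?mulr_ge0// exprMn in lip.
rewrite -(@ler_pXn2r _ 2) ?nnegrE ?mulr_ge0// exprMn in coe.
apply: le_trans lip _.
apply: (@le_trans _ _ (M ^+ 2 * (C ^+ 2 - mu) * `|F (u_ k) - y| ^+ 2)).
  rewrite -mulrA ler_wpM2l ?sqr_ge0// mulrBl.
  by apply: le_trans distk _; rewrite lerB.
by rewrite ler_piMl ?sqr_ge0// contraction_factor_le1.
Qed.

Theorem proposition2 (R : realType) (X U H Us : hilbertType R)
    (G : gelfand_triple U H Us) (T : R) (A : {linear X -> H})
    (f : R -> X -> U -> Us) (theta_d : X) (u_d : state G T)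
    (rad r Mr mur Ccoe : R) :
  let F : X -> state G T -> hsum (L2 T Us) H := all_at_once A f in
  let phi : hsum (L2 T Us) H := (0, 0) in
  0 < T -> 0 < rad -> 0 < r ->
  continuous A ->
  caratheodory T f ->
  nemytskii_defined G T f ->
  (forall (theta : X) (u : state G T), differentiable (F theta) u) ->
  F theta_d u_d = phi ->
  (forall theta : X, closed_ball theta_d rad theta ->
    exists2 us : state G T, closed_ball u_d (r / 2) us & F theta us = phi) ->
  0 < Mr -> 0 < mur -> 0 < Ccoe ->
  Mr < Num.sqrt 2 ->
  (forall (theta : X) (u v : state G T),
    closed_ball theta_d rad theta ->
    closed_ball u_d r u -> closed_ball u_d r v ->
    [/\ (opnorm ('d (F theta) u) <= Mr%:E)%E,
        2 * inner (F theta u - F theta v) ('d (F theta) u (u - v)) >=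
          (Mr ^+ 2 + mur) * `|F theta u - F theta v| ^+ 2 &
        Ccoe * `|F theta u - F theta v| >= `|u - v|]) ->
  forall (theta : X) (us : state G T) (u_ : nat -> state G T),
  closed_ball theta_d rad theta ->
  closed_ball u_d (r / 2) us -> F theta us = phi ->
  closed_ball us (r / 2) (u_ 0%N) ->
  (forall k : nat, u_ k.+1 =
    u_ k - adjoint ('d (F theta) (u_ k)) (F theta (u_ k) - phi)) ->
  (forall k : nat, injective (adjoint ('d (F theta) (u_ k)))) ->
  Ccoe ^+ 2 * (Ccoe ^+ 2 * Mr ^+ 2 - 1) < mur ->
  forall k : nat, `|F theta (u_ k.+1) - phi| <= `|F theta (u_ k) - phi|.
Proof.
move=> F phi _ _ r0 _ _ _ dF _ _ Mr0 mur0 C0 _ cond theta us u_ th.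
rewrite !closed_ballE ?divr_gt0// => us_near Fus u0_near uS inj small.
apply: (landweber_residual_decr (c := u_d) (r := r) (M := Mr) (mu := mur)
  (C := Ccoe) (dF theta) _ _ mur0 _ _ us_near Fus u0_near uS inj small).
- exact: ltW.
- exact: ltW.
- exact: ltW.
- by move=> u v ur vr; apply: cond => //; rewrite closed_ballE.
Qed.
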